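(* Let $\varepsilon\in[0,1]$, let $\mathcal{M}$ be a finite LMC, let some states in $\mathcal{M}$ be labeled with $g$, and let exactly the states that cannot reach a $g$-labeled state be labeled with $f$. Let $s\approx_\varepsilon^w t$ and let $N^w$ denote the random variable that counts the number of label changes until a $g$- or $f$-labeled state is reached. Then $|\mathrm{Pr}_s(\lozenge g)-\mathrm{Pr}_t(\lozenge g)|\le\varepsilon\cdot\mathbb{E}_s(N^w)$.
   Context: Fix a countable set $AP$ of atomic propositions, with distinct $g,f\in AP$. A labeled Markov chain (LMC) $\mathcal{M}=(S,P,s_{init},l)$ has a countable nonempty state set $S$, a transition function $P\colon S\to Distr(S)$ ($Distr(S)$ is the set of probability distributions on $S$), an initial state $s_{init}\in S$ and a labeling $l\colon S\to 2^{AP}$; it is finite if $S$ is finite. A state $u$ is labeled with $a\in AP$ if $a\in l(u)$. $\mathrm{Pr}_s$ and $\mathbb{E}_s$ are the standard probability measure and expectation on infinite paths starting in $s$. $\mathrm{Pr}_s(\lozenge g)$ is the probability of eventually visiting a $g$-labeled state. For $B,C\subseteq S$, $\mathrm{Pr}_s(B\,\mathsf{U}\,C)$ is the probability that a path from $s$ eventually visits $C$ with all states before the first visit to $C$ lying in $B$ (so it is $1$ if $s\in C$). $L(s)=\{t\in S\mid l(t)=l(s)\}$. For $R\subseteq S\times S$, $R(A)=\{t\mid\exists s\in A\colon(s,t)\in R\}$. A reflexive and symmetric $R$ is a weak $\varepsilon$-bisimulation if for all $(s,t)\in R$ and all $A\subseteq S$: $l(s)=l(t)$ and $\mathrm{Pr}_s(L(s)\,\mathsf{U}\,A)\le\mathrm{Pr}_t(L(t)\,\mathsf{U}\,R(A))+\varepsilon$.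 $s\approx_\varepsilon^w t$ if $(s,t)\in R$ for some weak $\varepsilon$-bisimulation $R$. For a path $s_0s_1s_2\dots$ whose first $g$- or $f$-labeled state is $s_k$, $N^w$ is the number of $i<k$ with $l(s_i)\ne l(s_{i+1})$. *)

(* Defs.v *)
From HB Require Import structures.
From mathcomp Require Import all_boot all_order all_algebra.
From mathcomp Require Import all_classical all_reals all_analysis.
From mathcomp Require Import lra.
Set Implicit Arguments.
Unset Strict Implicit.
Unset Printing Implicit Defensive.
Import Order.TTheory GRing.Theory Num.Theory.
Import numFieldNormedType.Exports.

Local Open Scope classical_set_scope.
Local Open Scope ring_scope.

Record finite_lmc (R : realType) (AP : countType) := FiniteLMC {
  state : finType;
  trans : state -> state -> R;
  trans_ge0 : forall s t, 0 <= trans s t;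
  trans_sum1 : forall s, \sum_t trans s t = 1;
  init : state;
  label : state -> set AP }.

Section UniformUnitInterval.
Context (R : realType).

Let measurable_itv01 : measurable (`[0, 1[ : set (measurableTypeR R)).
Proof. exact: measurable_itv. Qed.

Definition unif01 : set (measurableTypeR R) -> \bar R :=
  mrestr lebesgue_measure measurable_itv01.

HB.instance Definition _ := Measure.on unif01.

Let unif01_setT : unif01 setT = 1%E.
Proof.
by rewrite /unif01 /mrestr setTI lebesgue_measure_itv/= lte_fin ltr01 oppr0 adde0.
Qed.

HB.instance Definition _ :=
  Measure_isProbability.Build _ _ _ unif01 unif01_setT.

End UniformUnitInterval.

Section InfinitePaths.
Context (R : realType) (AP : countType) (M : finite_lmc R AP).
Implicit Types (s t : state M) (x : seq (state M)).

(* All sequences of states are admitted as paths; those that use a transition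
   of probability 0 are given probability 0 by the path measure. *)
Definition state_seq : Type := nat -> state M.

HB.instance Definition _ := Choice.copy state_seq (nat -> state M).
HB.instance Definition _ := isPointed.Build state_seq (fun=> init M).

Definition cylinder x : set state_seq := [set w | mkseq w (size x) = x].

Definition ipath : measurableType _ := g_sigma_algebraType (range cylinder).

Fixpoint weight s x : R :=
  if x is t :: x' then trans s t * weight t x' else 1.

Lemma weight_ge0 s x : 0 <= weight s x.
Proof. by elim: x s => //= t x ih s; rewrite mulr_ge0// trans_ge0. Qed.

(* Existence of the path measure: a number of [0, 1[ chosen uniformly encodes a
   path, its successive digits being read off in the mixed radix given by the
   transition probabilities. *)

Let cum s t : R := \sum_(t' | (enum_rank t' < enum_rank t)%N) trans s t'.

Let nextb s (u : R) t : bool := (cum s t <= u) && (u < cum s t + trans s t).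
Let next s u := odflt s [pick t | nextb s u t].
Let step (su : state M * R) : state M * R :=
  let t := next su.1 su.2 in (t, (su.2 - cum su.1 t) / trans su.1 t).
Let traj s u : ipath := fun n => (iter n step (s, u)).1.

Let cum_ge0 s t : 0 <= cum s t.
Proof. by apply: sumr_ge0 => ? _; exact: trans_ge0. Qed.

Let cumD s t :
  cum s t + trans s t = \sum_(t' | (enum_rank t' <= enum_rank t)%N) trans s t'.
Proof.
rewrite [RHS](bigD1 t)//= addrC; congr (_ + _); apply: eq_bigl => t'.
rewrite ltn_neqAle andbC; congr (_ && _).
by rewrite -(inj_eq enum_rank_inj).
Qed.

Let cumD_le s t t' : (enum_rank t < enum_rank t')%N ->
  cum s t + trans s t <= cum s t'.
Proof.
move=> tt'; rewrite cumD /cum big_mkcond [leRHS]big_mkcond/=.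
apply: ler_sum => v _; case: ifPn => vt; case: ifPn => // vt'.
- by rewrite (leq_ltn_trans vt tt') in vt'.
- exact: trans_ge0.
Qed.

Let cumD_le1 s t : cum s t + trans s t <= 1.
Proof.
rewrite cumD -(trans_sum1 s) big_mkcond/=.
by apply: ler_sum => v _; case: ifPn => // _; exact: trans_ge0.
Qed.

Let nextb_inj s u t t' : nextb s u t -> nextb s u t' -> t = t'.
Proof.
move=> /andP[h1 h2] /andP[h3 h4]; apply: enum_rank_inj; apply: val_inj => /=.
case: (ltngtP (enum_rank t) (enum_rank t')) => [/(cumD_le s) h5|/(cumD_le s) h5|//];
  exfalso; lra.
Qed.

Let nextb_exists s (u : R) : 0 <= u < 1 -> exists t, nextb s u t.
Proof.
move=> /andP[u0 u1].
have [t ut tmin] : exists2 t, u < cum s t + trans s t &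
    forall t', u < cum s t' + trans s t' -> (enum_rank t <= enum_rank t')%N.
  have n0 : (0 < #|state M|)%N by apply/card_gt0P; exists s.
  have nn : (#|state M|.-1 < #|state M|)%N by rewrite prednK.
  pose last := enum_val (Ordinal nn).
  have lastP : u < cum s last + trans s last.
    rewrite cumD (eq_bigl xpredT) ?trans_sum1// => t'.
    by rewrite enum_valK/= -ltnS prednK// ltn_ord.
  case: (@arg_minnP _ last (fun t => u < cum s t + trans s t)
    (fun t => enum_rank t : nat) lastP) => m mP mmin.
  by exists m.
exists t; rewrite /nextb ut andbT leNgt; apply/negP => ult.
have [t0|t0] := posnP (enum_rank t).
  move: ult; rewrite /cum big_pred0; first by rewrite ltNge u0.
  by move=> v; rewrite t0.
have pt : ((enum_rank t).-1 < #|state M|)%N.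
  by rewrite (leq_ltn_trans (leq_pred _))// ltn_ord.
have := tmin (enum_val (Ordinal pt)).
rewrite cumD enum_valK/= (eq_bigl (fun v => (enum_rank v < enum_rank t)%N)).
  by move=> /(_ ult); rewrite leqNgt prednK// leqnn.
by move=> v; rewrite -ltnS prednK.
Qed.

Let nextP s (u : R) t : 0 <= u < 1 -> (next s u = t) <-> nextb s u t.
Proof.
move=> u01; rewrite /next; case: pickP => [t' t'P|nP]; last first.
  by have [t' t'P] := nextb_exists s u01; rewrite nP in t'P.
by split=> [<-//|]; exact: nextb_inj.
Qed.

Let traj_cons s u n : mkseq (traj s u) n.+1 =
  s :: mkseq (traj (step (s, u)).1 (step (s, u)).2) n.
Proof.
rewrite /mkseq /= -[1%N]addn0 iotaDl -map_comp; congr (_ :: _).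
by apply: eq_map => k; exact: (congr1 fst (iterSr k step (s, u))).
Qed.

Let traj_itv x s : exists2 a : R, 0 <= a /\ a + weight s x <= 1 &
  forall u : R, 0 <= u < 1 ->
    mkseq (traj s u) (size x).+1 = s :: x <-> a <= u < a + weight s x.
Proof.
elim: x s => [|t x ih] s /=.
  by exists 0; [rewrite add0r|move=> u; rewrite add0r => ->].
have [a [a0 a1] aP] := ih t.
have [p0|p0] := eqVneq (trans s t) 0.
  exists 0; first by rewrite p0 mul0r addr0.
  move=> u u01; rewrite traj_cons/= p0 mul0r addr0; split; last by move=> ?; exfalso; lra.
  by case=> /(nextP s t u01) + _; rewrite /nextb p0 => ?; exfalso; lra.
have {}p0 : 0 < trans s t by rewrite lt_neqAle eq_sym p0 trans_ge0.
have w0 := weight_ge0 t x.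
have c0 := cum_ge0 s t; have c1 := cumD_le1 s t.
exists (cum s t + trans s t * a).
  split; first by rewrite addr_ge0 ?mulr_ge0// ltW.
  rewrite -addrA -mulrDr (le_trans _ c1)// lerD2l.
  by rewrite -[leRHS]mulr1 ler_pM2l.
move=> u u01; rewrite traj_cons.
have fE : a <= (u - cum s t) / trans s t < a + weight t x =
    (cum s t + trans s t * a <= u <
     cum s t + trans s t * a + trans s t * weight t x).
  rewrite ler_pdivlMr// ltr_pdivrMr// lerBrDl ltrBlDl mulrC.
  by rewrite (mulrC (a + _)) mulrDr addrA.
have nf : nextb s u t -> 0 <= (u - cum s t) / trans s t < 1.
  by rewrite /nextb ler_pdivlMr// ltr_pdivrMr// mul0r mul1r; lra.
have stepE : nextb s u t -> step (s, u) = (t, (u - cum s t) / trans s t).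
  by move=> /(nextP s t u01); rewrite /step/= => ->.
split=> [h|h].
  have h' : mkseq (traj (step (s, u)).1 (step (s, u)).2) (size x).+1 = t :: x.
    by move/eqP: h; rewrite eqseq_cons eqxx => /eqP.
  have n1 : nextb s u t.
    by apply/(nextP s t u01); have := congr1 (head s) h'.
  by rewrite stepE// in h'; rewrite -fE; exact/(aP _ (nf n1)).
have n1 : nextb s u t.
  have pa : 0 <= trans s t * a by rewrite mulr_ge0// ltW.
  have : trans s t * (a + weight t x) <= trans s t by rewrite ger_pMr.
  by move: h; rewrite /nextb mulrDr; lra.
rewrite stepE//; congr (_ :: _); move: h; rewrite -fE => h.
exact/(aP _ (nf n1)).
Qed.

Let clamp (u : R) : R := if 0 <= u < 1 then u else 0.
Let code s u : ipath := traj s (clamp u).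

Let code_itv v x s : exists2 b : R, 0 <= b &
  code s @^-1` cylinder (v :: x) `&` `[0, 1[ =
  [set` `[b, b + (v == s)%:R * weight v x[] :> set R.
Proof.
have [vs|vs] := eqVneq v s; last first.
  exists 0 => //; rewrite mul0r addr0; apply/seteqP; split => u /=; last first.
    by rewrite in_itv/= => ?; exfalso; lra.
  rewrite /cylinder/= => -[+ _]; rewrite /code traj_cons => -[/esym e].
  by rewrite e eqxx in vs.
have [b [b0 b1] bP] := traj_itv x s.
exists b => //; rewrite vs mul1r; apply/seteqP; split => u /=.
  rewrite in_itv/= /code => -[h u01]; rewrite in_itv/=.
  by move: h; rewrite /clamp u01 /cylinder/= => /(bP u u01).
rewrite !in_itv/= => h; have u01 : 0 <= u < 1 by lra.
by split => //; rewrite /code /clamp u01 /cylinder/=; apply/(bP u u01).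
Qed.

Let measurable_code s :
  @measurable_fun _ _ (measurableTypeR R) ipath setT (code s).
Proof.
apply: (@measurability _ _ _ ipath _ _ (range cylinder)) => // _ [_ [x _ <-] <-].
rewrite setTI.
case: x => [|v x].
  rewrite (_ : code s @^-1` cylinder [::] = setT); first exact: measurableT.
  by apply/seteqP; split.
have mI : @measurable _ (measurableTypeR R)
    (code s @^-1` cylinder (v :: x) `&` `[0, 1[).
  by have [b _ ->] := code_itv v x s; exact: measurable_itv.
have -> : code s @^-1` cylinder (v :: x) =
    (code s @^-1` cylinder (v :: x) `&` `[0, 1[) `|`
    (if `[< cylinder (v :: x) (code s 0) >] then ~` `[0, 1[ else set0).
  have h0 u : ~ [set` `[(0:R), 1[] u -> code s u = code s 0.
    rewrite /= in_itv/= => /negP h.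
    by rewrite /code /clamp (negbTE h) lexx ltr01.
  apply/seteqP; split => u.
    have [uI|uI] := pselect ([set` `[(0:R), 1[] u); first by left.
    rewrite /preimage/= => h; right; move: h; rewrite (h0 u uI) => h.
    by case: asboolP.
  case=> [[]//|]; case: asboolP => // c /h0 e.
  by rewrite /preimage/= e.
apply: measurableU => //; case: ifPn => // _.
by apply: measurableC; exact: measurable_itv.
Qed.

Lemma path_measure_exists s : exists mu : probability ipath R,
  forall v x, mu (cylinder (v :: x)) = ((v == s)%:R * weight v x)%:E.
Proof.
pose X : {mfun measurableTypeR R >-> ipath} :=
  @mfun_Sub _ _ (measurableTypeR R) ipath (code s) (mem_set (measurable_code s)).
exists (distribution (@unif01 R) X) => v x.
have [b b0 e] := code_itv v x s.
transitivity
  (lebesgue_measure (code s @^-1` cylinder (v :: x) `&` `[0, 1[ : set R)).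
  by [].
rewrite e lebesgue_measure_itv/= lte_fin.
set c := _ * _; have c0 : 0 <= c by rewrite mulr_ge0// weight_ge0.
case: ltP => [_|cb]; first by rewrite -EFinD addrAC subrr add0r.
by congr EFin; lra.
Qed.

Definition path_measure s : probability ipath R :=
  projT1 (cid (path_measure_exists s)).

Lemma path_measure_cylinder s v x :
  path_measure s (cylinder (v :: x)) = ((v == s)%:R * weight v x)%:E.
Proof. exact: (projT2 (cid (path_measure_exists s))). Qed.

End InfinitePaths.

Section WeakBisimulation.
Context (R : realType) (AP : countType) (M : finite_lmc R AP).
Implicit Types (s t u : state M) (w : ipath M).

Definition eventually_event (a : AP) : set (ipath M) :=
  [set w | exists n, label (w n) a].

Definition until_event (B C : set (state M)) : set (ipath M) :=
  [set w | exists n, [/\ C (w n), (forall i, (i < n)%N -> ~ C (w i)) &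
                         forall i, (i < n)%N -> B (w i)]].

Definition same_label s : set (state M) := [set t | label t = label s].

Definition rel_image (B : state M -> state M -> Prop) (A : set (state M)) :
  set (state M) := [set t | exists2 s, A s & B s t].

Definition weak_bisimulation (eps : R) (B : state M -> state M -> Prop) :=
  [/\ forall s, B s s,
      forall s t, B s t -> B t s &
      forall s t (A : set (state M)), B s t ->
        label s = label t /\
        (path_measure s (until_event (same_label s) A) <=
         path_measure t (until_event (same_label t) (rel_image B A))
           + eps%:E)%E].

Definition weakly_bisimilar (eps : R) s t :=
  exists2 B, weak_bisimulation eps B & B s t.

Definition can_reach_label u (a : AP) :=
  exists2 v, connect [rel s t | 0 < trans s t] u v & label v a.

Definition first_hit (g f : AP) w (k : nat) :=
  (label (w k) g \/ label (w k) f) /\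
  forall i, (i < k)%N -> ~ (label (w i) g \/ label (w i) f).

Definition label_changes w (k : nat) : nat :=
  #|[pred i : 'I_k | `[< label (w i) <> label (w i.+1) >]]|.

(* The value is 0 on the paths that never visit a g- or f-labeled state. When
   f labels exactly the states that cannot reach a g-labeled state, these paths
   have probability 0. *)
Definition label_changes_until (g f : AP) w : nat :=
  label_changes w (xget 0%N [set k | first_hit g f w k]).

End WeakBisimulation.

(* Main.v *)
Require Import Defs.
From mathcomp Require Import all_boot all_order all_algebra.
From mathcomp Require Import all_classical all_reals all_analysis.
From mathcomp Require Import lra measurable_realfun.
Set Implicit Arguments.
Unset Strict Implicit.
Unset Printing Implicit Defensive.
Import Order.TTheory GRing.Theory Num.Theory.
Local Open Scope ring_scope.

(* Write K s u for the probability that u is the first state off the label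
   class of s, and p s for the probability of reaching g. As long as s is
   labeled neither g nor f, the class is left almost surely, so p s is the
   K s-mean of p. If s and t are related, the weak bisimulation condition says
   that K s A <= K t (R A) + eps for every set A off the class; splitting
   [0,1]-valued functions into level sets turns this into
   K s h <= K t h' + eps whenever h u <= h' v for all related u and v. With
   D s the largest |p s - p t| over the states t related to s, the choices
   h = p, h' = p + D and h = 1 - p, h' = 1 - p + D yield
   D s <= eps + K s D: one eps is paid per label change. Unfolding this n
   times bounds D by eps times the expected number of label changes among the
   first n steps, plus an error proportional to the probability of not having
   visited g or f by then. *)

(** * One-step decomposition of the path measure *)

Section PathMeasure.
Local Open Scope classical_set_scope.
Context (R : realType) (AP : countType) (M : finite_lmc R AP).
Implicit Types (s t u : state M) (w : ipath M) (E : set (ipath M)).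

Lemma measurable_cylinder (x : seq (state M)) :
  measurable (cylinder x : set (ipath M)).
Proof. by apply: sub_sigma_algebra; exists x. Qed.

Lemma measurable_coord (Q : state M -> Prop) n :
  measurable ([set w | Q (w n)] : set (ipath M)).
Proof.
(* An event about time [n] is a finite union of cylinders over words of length [n + 1]. *)
have -> : [set w : ipath M | Q (w n)] = \bigcup_(x : n.+1.-tuple (state M))
    (if `[< Q (tnth x ord_max) >] then cylinder x else set0).
  apply/seteqP; split => w /=.
    move=> Qw; exists (mktuple (fun i : 'I_n.+1 => w i)) => //.
    rewrite tnth_mktuple/=; case: asboolP => // _.
    rewrite /cylinder/= size_map size_enum_ord /mkseq -val_enum_ord -map_comp.
    exact: eq_map.
  case=> x _; case: asboolP => // + e; congr Q.
  rewrite (tnth_nth (w 0%N))/= -e size_tuple nth_mkseq//.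
apply: countable_bigcupT_measurable => [|x]; first exact: countableP.
by case: ifP => // _; exact: measurable_cylinder.
Qed.

(** Pulling an event back along [cons_path s] shifts time by one; the Markov property is phrased
    through these preimages. *)
Definition cons_path s w : ipath M := fun n => if n is m.+1 then w m else s.

Lemma mkseq_cons_path s w n :
  mkseq (cons_path s w) n.+1 = s :: mkseq w n.
Proof.
by rewrite /mkseq /= -[1%N]addn0 iotaDl -map_comp.
Qed.

Lemma cons_path_cylinder s t x :
  cons_path s @^-1` cylinder (t :: x) = if t == s then cylinder x else set0.
Proof.
apply/seteqP; split => w; rewrite /cylinder /preimage/=.
  by rewrite [mkseq _ _]mkseq_cons_path => -[-> <-]; rewrite eqxx/= size_mkseq.
case: eqVneq => // -> xw; rewrite [mkseq _ _]mkseq_cons_path; congr cons.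
exact: xw.
Qed.

Lemma cylinder_nil : cylinder [::] = setT :> set (ipath M).
Proof. by apply/seteqP; split. Qed.

Lemma measurable_cons_path s : measurable_fun setT (cons_path s).
Proof.
apply: (@measurability _ _ _ (ipath M) _ _ (range (@cylinder _ _ M))).
  by [].
move=> _ [_ [x _ <-] <-]; rewrite setTI.
case: x => [|t x]; first by rewrite cylinder_nil preimage_setT; exact: measurableT.
by rewrite cons_path_cylinder; case: ifP => // _; exact: measurable_cylinder.
Qed.

Lemma measurable_cons_preimage s E :
  measurable E -> measurable (cons_path s @^-1` E).
Proof.
by move=> mE; rewrite -[X in measurable X]setTI; exact: measurable_cons_path.
Qed.

(** Two cylinders are nested or disjoint, so together with the empty set they form a pi-system. *)
Lemma cylinderI_sub (x y : seq (state M)) : (size x <= size y)%N ->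
  cylinder x `&` cylinder y =
    if take (size x) y == x then cylinder y else set0 :> set (ipath M).
Proof.
move=> xy; have tk (w : ipath M) :
    mkseq w (size x) = take (size x) (mkseq w (size y)).
  by rewrite /mkseq -map_take take_iota (minn_idPl xy).
apply/seteqP; split => w; rewrite /cylinder/=.
  by rewrite tk => -[+ e]; rewrite e => ->; rewrite eqxx.
by case: eqP => // e e'; split => //; rewrite tk e'.
Qed.

Lemma path_measure_unique (m1 m2 : {measure set (ipath M) -> \bar R}) E :
  (m1 setT < +oo)%E ->
  (forall x, m1 (cylinder x) = m2 (cylinder x)) -> measurable E -> m1 E = m2 E.
Proof.
move=> m1T m12.
apply: (@measure_unique _ _ (ipath M) (set0 |` range (@cylinder _ _ M))
  (fun=> setT)) => //.
- apply/seteqP; split => A.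
    by apply: sub_sigma_algebra2 => B; right.
  apply: smallest_sub; first exact: sigma_algebra_measurable.
  by move=> B [->|[x _ <-]]; [exact: measurable0|exact: measurable_cylinder].
- move=> A B [->|[x _ <-]]; first by rewrite set0I; left.
  case=> [->|[y _ <-]]; first by rewrite setI0; left.
  have [xy|/ltnW xy] := leqP (size x) (size y).
    by rewrite cylinderI_sub//; case: ifP; [right; exists y|left].
  by rewrite setIC cylinderI_sub//; case: ifP; [right; exists x|left].
- by move=> _; right; exists [::]; rewrite ?cylinder_nil.
- by apply/seteqP; split => // w _; exists 0%N.
- by move=> A [->|[x _ <-]]; rewrite ?measure0.
Qed.

Lemma path_measureT s : path_measure s setT = 1%E.
Proof. exact: probability_setT. Qed.

(** Markov property at time one: both sides are finite measures in [E], so agreement on cylinders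
    suffices. *)
Lemma path_measure_step s E : measurable E ->
  path_measure s E =
  (\sum_t (trans s t)%:E * path_measure t (cons_path s @^-1` E))%E.
Proof.
pose F_ t : {measure set (ipath M) -> \bar R} := mscale (NngNum (trans_ge0 s t))
  (pushforward (path_measure t) (cons_path s)).
pose F := F_ (measurable_cons_path s).
have F_E t A :
    F t A = ((trans s t)%:E * path_measure t (cons_path s @^-1` A))%E by [].
(* [msum] is indexed by naturals, so the states are enumerated; the default [s] of [nth] is never
   reached. *)
pose N := msum (fun n => F (nth s (enum (state M)) n)) #|state M|.
have NE A : N A = (\sum_t F t A)%E.
  by rewrite /N /msum cardE -[RHS]big_enum (big_nth s) big_mkord.
move=> mE; transitivity (N E); last by rewrite NE.
apply: path_measure_unique => //; first by rewrite [ltLHS]path_measureT ltry.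
move=> x; transitivity (\sum_t F t (cylinder x))%E; last exact/esym/NE.
rewrite -[LHS]/(path_measure s (cylinder x)); under eq_bigr do rewrite F_E.
case: x => [|v [|u x]].
- rewrite cylinder_nil [LHS]path_measureT preimage_setT.
  under eq_bigr do rewrite path_measureT mule1.
  by rewrite sumEFin trans_sum1.
- rewrite cons_path_cylinder path_measure_cylinder cylinder_nil/= mulr1.
  case: eqVneq => _; last by rewrite big1// => t _; rewrite measure0 mule0.
  under eq_bigr do rewrite path_measureT mule1.
  by rewrite sumEFin trans_sum1.
- rewrite cons_path_cylinder path_measure_cylinder/=.
  case: eqVneq => [->|_]; last first.
    by rewrite mul0r big1// => t _; rewrite measure0 mule0.
  under eq_bigr do rewrite path_measure_cylinder -EFinM.
  rewrite sumEFin (bigD1 u)//= eqxx !mul1r big1 ?addr0// => t tu.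
  by rewrite eq_sym (negbTE tu) mul0r mulr0.
Qed.

Definition prob s E : R := fine (path_measure s E).

Lemma probE s E : measurable E -> path_measure s E = (prob s E)%:E.
Proof. by move=> mE; rewrite /prob fineK// fin_num_measure. Qed.

Lemma prob_ge0 s E : 0 <= prob s E.
Proof. by rewrite fine_ge0. Qed.

Lemma prob_le1 s E : measurable E -> prob s E <= 1.
Proof. by move=> mE; rewrite -lee_fin -probE// probability_le1. Qed.

Lemma prob_step s E : measurable E ->
  prob s E = \sum_t trans s t * prob t (cons_path s @^-1` E).
Proof.
move=> mE; apply: EFin_inj; rewrite -probE// path_measure_step//.
rewrite -sumEFin; apply: eq_bigr => t _.
by rewrite EFinM -probE//; exact: measurable_cons_preimage.
Qed.

(** The cylinder [[:: s]] has probability one, so an event decided by the first state is null or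
    full. *)
Lemma prob_start s E (b : bool) : measurable E ->
  (forall w, w 0%N = s -> E w <-> b) -> prob s E = b%:R.
Proof.
move=> mE Eb; have sE : path_measure s (cylinder [:: s]) = 1%E.
  by rewrite path_measure_cylinder eqxx mulr1.
have ms := measurable_cylinder [:: s].
have E0 (A : set (ipath M)) : measurable A -> A `&` cylinder [:: s] = set0 ->
    path_measure s A = 0%E.
  move=> mA A0; apply/eqP; rewrite eq_le measure_ge0 andbT.
  have -> : 0%E = path_measure s (~` cylinder [:: s]).
    by rewrite probability_setC// sE subee.
  rewrite le_measure ?inE//; first exact: measurableC.
  by apply/disjoints_subset.
rewrite /prob; case: b Eb => Eb.
  rewrite -[E]setCK probability_setC; last exact: measurableC.
  rewrite (E0 (~` E)); first by rewrite sube0.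
    exact: measurableC.
  apply/seteqP; split => // w [/= nE [w0]]; apply: nE.
  by apply/Eb.
rewrite E0//; apply/seteqP; split => // w [/= Ew [w0]].
by have := (Eb w w0).1 Ew.
Qed.

End PathMeasure.

(** * From sets to functions *)

Section Domination.
Local Open Scope classical_set_scope.
Context (R : realType) (T : finType) (rel : T -> T -> Prop).
Variables (mu nu : T -> R) (eps : R).
Hypothesis nu_ge0 : forall v, 0 <= nu v.
Hypothesis dom : forall A : set T,
  \sum_(u in A) mu u <= \sum_(v in [set v | exists2 u, A u & rel u v]) nu v + eps.

(** Layer-cake argument by induction on the size of the support of [h]: removing a layer of height
    [m] costs [m * eps] and lowers the bound [c] to [c - m]. *)
Lemma weighted_sum_domination (c : R) (h H : T -> R) :
  0 <= c -> (forall u, 0 <= h u <= c) -> (forall v, 0 <= H v) ->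
  (forall u v, rel u v -> h u <= H v) ->
  \sum_u mu u * h u <= \sum_v nu v * H v + c * eps.
Proof.
have [n] := ubnP #|[pred u | h u != 0]|.
elim: n => // n IH in c h H * => hn c0 hc H0 hH.
(* The empty set in [dom] yields the sign of [eps]. *)
have eps0 : 0 <= eps.
  have := dom set0; rewrite !big_pred0 ?add0r// => v; apply/negbTE.
    by rewrite notin_setE => -[].
  by rewrite notin_setE.
have [h0|[u0 hu0]] : (forall u, h u = 0) \/ (exists u, h u != 0).
  have [|nh] := pselect (exists u, h u != 0); first by right.
  by left => u; apply/eqP; apply: contra_notT nh => hu; exists u.
  rewrite big1 => [|u _]; last by rewrite h0 mulr0.
  by rewrite addr_ge0 ?mulr_ge0// sumr_ge0// => v _; rewrite mulr_ge0.
case: (@Order.TotalTheory.arg_minP _ _ _ u0 (fun u => h u != 0) h hu0) => a ha amin.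
(* The layer has the least nonzero value of [h] as its height. On the image [B] of the support, [H]
   is at least [m], so subtracting the layer keeps [H] nonnegative, while [h] vanishes at [a] and
   its support shrinks. *)
set m := h a in amin; pose A := [set u | h u != 0].
pose B := [set v | exists2 u, A u & rel u v].
have m0 : 0 < m by rewrite lt_neqAle eq_sym ha; case/andP: (hc a).
have hE u : h u = (h u - (u \in A)%:R * m) + (u \in A)%:R * m by rewrite subrK.
have HE v : H v = (H v - (v \in B)%:R * m) + (v \in B)%:R * m by rewrite subrK.
have sumE (D : set T) (k : T -> R) :
    \sum_u k u * ((u \in D)%:R * m) = m * \sum_(u in D) k u.
  rewrite mulr_sumr [RHS]big_mkcond; apply: eq_bigr => u _.
  by case: ifP; rewrite ?mul1r ?mul0r ?mulr0// mulrC.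
rewrite (eq_bigr (fun u => mu u * (h u - (u \in A)%:R * m) +
                           mu u * ((u \in A)%:R * m))); last first.
  by move=> u _; rewrite -mulrDr -hE.
rewrite [X in _ <= X + _](eq_bigr (fun v => nu v * (H v - (v \in B)%:R * m) +
                           nu v * ((v \in B)%:R * m))); last first.
  by move=> u _; rewrite -mulrDr -HE.
rewrite !big_split/= !sumE.
have mB v : v \in B -> m <= H v.
  by rewrite inE => -[u Au /hH]; apply: le_trans; exact: amin.
have : \sum_u mu u * (h u - (u \in A)%:R * m) <=
    \sum_v nu v * (H v - (v \in B)%:R * m) + (c - m) * eps.
  apply: IH.
  - rewrite -ltnS (leq_trans _ hn)// ltnS; apply: proper_card; apply/properP; split.
      apply/fintype.subsetP => u; rewrite !inE; apply: contraNN => /eqP hu0'.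
      by rewrite hu0' memNset ?mul0r ?subrr// /A/= hu0' eqxx.
    by exists a; rewrite !inE// mem_set// mul1r subrr eqxx.
  - by rewrite subr_ge0; case/andP: (hc a).
  - move=> u; have /andP[hu0' huc] := hc u.
    have [uA|uA] := boolP (u \in A).
      by move: (uA); rewrite inE => /amin; rewrite mul1r; lra.
    rewrite mul0r subr0 hu0'/=; move: uA; rewrite notin_setE/= => /negP.
    rewrite negbK => /eqP ->; rewrite subr_ge0; by case/andP: (hc a).
  - move=> v; case: (boolP (v \in B)) => [/mB|_]; rewrite ?mul1r ?mul0r ?subr0//.
    by rewrite subr_ge0.
  - move=> u v uv; have := hH _ _ uv; have [uA|uA] := boolP (u \in A).
      have -> : v \in B by apply/mem_set; exists u => //; exact: set_mem.
      by rewrite !mul1r lerD2r.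
    have -> : h u = 0.
      by move: uA; rewrite notin_setE/= => /negP; rewrite negbK => /eqP.
    rewrite mul0r subr0 => _.
    case: (boolP (v \in B)) => [/mB|_]; rewrite ?mul1r ?mul0r ?subr0//.
    by rewrite subr_ge0.
have := ler_wpM2l (ltW m0) (dom A); rewrite -/B mulrDr mulrBl; lra.
Qed.

End Domination.

(** * Maximum principle *)

Section MaximumPrinciple.
Local Open Scope classical_set_scope.
Context (R : realType) (AP : countType) (M : finite_lmc R AP).
Implicit Types (s t u v : state M) (L : set (state M)).

(** A condition on the transition graph alone; as the chain is finite, it forces almost sure exit
    ([prob_stays_forever]). *)
Definition leaves L := forall s, L s ->
  exists2 v, connect [rel s t | 0 < trans s t] s v & ~ L v.

(** A positive maximum can only sit in [L]; averaging carries it to every successor, hence along a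
    path out of [L], where [d] is nonpositive. *)
Lemma maximum_principle L (d : state M -> R) : leaves L ->
  (forall s, L s -> d s <= \sum_t trans s t * d t) ->
  (forall s, ~ L s -> d s <= 0) -> forall s, d s <= 0.
Proof.
move=> Lv dL dN s.
case: (@Order.TotalTheory.arg_maxP _ _ _ s xpredT d isT) => m _ mmax.
apply: (le_trans (mmax s isT)); rewrite leNgt; apply/negP => dm0.
have Lm u : d u = d m -> L u.
  by move=> um; apply: contrapT => /dN; rewrite um leNgt dm0.
have next u v : d u = d m -> 0 < trans u v -> d v = d m.
  move=> um uv; have /dL := Lm _ um.
  (* The mean of [d] at [u] reaches the maximum, so the nonnegative weighted deficits sum to zero
     and each vanishes. *)
  have Pm : \sum_t trans u t * d m = d m by rewrite -mulr_suml trans_sum1 mul1r.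
  rewrite um -[X in X <= _]Pm -subr_le0 -sumrB => le0.
  have ge0 t : true -> 0 <= trans u t * d m - trans u t * d t.
    by move=> _; rewrite -mulrBr mulr_ge0 ?trans_ge0// subr_ge0; exact: mmax.
  have /psumr_eq0P : \sum_t (trans u t * d m - trans u t * d t) = 0.
    by apply/eqP; rewrite eq_le le0 sumr_ge0.
  move=> /(_ ge0 v isT)/eqP; rewrite -mulrBr mulf_eq0 gt_eqF//= subr_eq0.
  by move/eqP.
have [v /connectP[p pp ->]] := Lv m (Lm _ erefl); apply; apply: Lm.
have conn y : d y = d m -> path [rel s t | 0 < trans s t] y p ->
    d (last y p) = d m.
  elim: p y {pp} => [//|x p ih] y ym /= /andP[yx xp].
  by apply: ih => //; exact: next yx.
exact: conn.
Qed.

Lemma maximum_principle_eq0 L (d : state M -> R) : leaves L ->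
  (forall s, L s -> d s = \sum_t trans s t * d t) ->
  (forall s, ~ L s -> d s = 0) -> forall s, d s = 0.
Proof.
move=> Lv dL dN s; apply/eqP; rewrite eq_le; apply/andP; split.
  by apply: (maximum_principle Lv) => [u /dL <-|u /dN ->].
rewrite -oppr_le0; apply: (maximum_principle Lv (d := fun u => - d u)).
  by move=> u /dL ->; rewrite -sumrN ler_sum// => t _; rewrite mulrN.
by move=> u /dN ->; rewrite oppr0.
Qed.

End MaximumPrinciple.

(** * Reachability and exit distributions *)

Section Reachability.
Local Open Scope classical_set_scope.
Context (R : realType) (AP : countType) (M : finite_lmc R AP).
Implicit Types (s t u v : state M) (L A B C : set (state M)) (w : ipath M).

Lemma measurable_prefix (Q : state M -> Prop) n :
  measurable ([set w | forall i, (i < n)%N -> Q (w i)] : set (ipath M)).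
Proof.
have -> : [set w : ipath M | forall i, (i < n)%N -> Q (w i)] =
    \bigcap_(i in `I_n) [set w | Q (w i)] by apply/seteqP; split.
by apply: bigcap_measurableType => // i _; exact: measurable_coord.
Qed.

Lemma measurable_label_coord a n :
  measurable ([set w | label (w n) a] : set (ipath M)).
Proof. exact: (measurable_coord (fun s => label s a)). Qed.

Lemma eventually_bigcup a :
  eventually_event a = \bigcup_n [set w : ipath M | label (w n) a].
Proof. by apply/seteqP; split => [w [n ?]|w [n _ ?]]; exists n. Qed.

Lemma measurable_eventually a :
  measurable (eventually_event a : set (ipath M)).
Proof.
rewrite eventually_bigcup; apply: bigcupT_measurable => n.
exact: measurable_label_coord.
Qed.

Lemma measurable_until B C : measurable (until_event B C : set (ipath M)).
Proof.
have -> : until_event B C = \bigcup_n ([set w : ipath M | C (w n)] `&`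
    ([set w | forall i, (i < n)%N -> ~ C (w i)] `&`
     [set w | forall i, (i < n)%N -> B (w i)])).
  by apply/seteqP; split => [w [n [? ? ?]]|w [n _ [? [? ?]]]]; exists n.
apply: bigcupT_measurable => n; apply: measurableI; first exact: measurable_coord.
apply: measurableI; first exact: (measurable_prefix (fun s => ~ C s)).
exact: measurable_prefix.
Qed.

Lemma eventually_cons a s : ~ label s a ->
  cons_path s @^-1` eventually_event a = eventually_event a.
Proof.
move=> sa; apply/seteqP; split => w; last by case=> n wn; exists n.+1.
by case=> -[|n] //= wn; exists n.
Qed.

Lemma until_cons B C s : B s -> ~ C s ->
  cons_path s @^-1` until_event B C = until_event B C.
Proof.
move=> sB sC; apply/seteqP; split => w /=.
  case=> -[|n] [] //= wn nC nB; exists n; split => // i ni.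
    exact: (nC i.+1).
  exact: (nB i.+1).
case=> n [wn nC nB]; exists n.+1; split => // -[|i]//; [exact: nC|exact: nB].
Qed.

Lemma prob_eventually_step a s : ~ label s a ->
  prob s (eventually_event a) = \sum_t trans s t * prob t (eventually_event a).
Proof.
move=> sa; rewrite prob_step; last exact: measurable_eventually.
by rewrite eventually_cons.
Qed.

Lemma prob_eventually1 a s : label s a -> prob s (eventually_event a) = 1.
Proof.
move=> sa; apply: (prob_start (b := true)); first exact: measurable_eventually.
by move=> w w0; split => // _; exists 0%N; rewrite w0.
Qed.

(** Hitting [a] at a fixed time is null, by induction on that time; countable subadditivity does the
    rest. *)
Lemma prob_eventually0 a s : ~ can_reach_label s a ->
  prob s (eventually_event a) = 0.
Proof.
have ma := measurable_label_coord a.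
move=> sa; have E0 n : path_measure s [set w : ipath M | label (w n) a] = 0%E.
  rewrite probE//; congr EFin; elim: n s sa => [|n ih] s sa.
    apply: (prob_start (b := false)); first exact: (ma 0%N).
    move=> w w0; split => //= la; exfalso; apply: sa; exists s => //.
    by rewrite -w0.
  rewrite prob_step//; apply: big1 => t _; rewrite [X in prob _ X](_ : _ =
    [set w : ipath M | label (w n) a]) //.
  have [st|st] := ltP 0 (trans s t).
    rewrite ih ?mulr0// => -[v tv va]; apply: sa; exists v => //.
    exact: connect_trans (connect1 st) tv.
  rewrite (_ : trans s t = 0) ?mul0r//.
  by apply/eqP; rewrite eq_le st trans_ge0.
rewrite /prob (_ : path_measure s _ = 0%E)//; apply/eqP.
rewrite eq_le measure_ge0 andbT eventually_bigcup.
apply: le_trans (generalized_Boole_inequality _ ma _) _.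
  exact: bigcupT_measurable.
by rewrite eseries0// => i _ _; exact: E0.
Qed.

Lemma prob_until_out L A s : ~ L s -> prob s (until_event L A) = (s \in A)%:R.
Proof.
move=> Ls; apply: prob_start; first exact: measurable_until.
move=> w w0; split; last by move=> /set_mem sA; exists 0%N; split; rewrite ?w0.
case=> -[|n] [wn _ nL]; first by rewrite -w0; exact: mem_set.
by exfalso; apply: Ls; rewrite -w0; exact: nL.
Qed.

Lemma prob_until_step L A s : L s -> ~ A s ->
  prob s (until_event L A) = \sum_t trans s t * prob t (until_event L A).
Proof.
by move=> Ls As; rewrite prob_step ?until_cons//; exact: measurable_until.
Qed.

(** For [u] outside [L] this is the exit distribution, the kernel [K] of the overview. *)
Definition exit_prob L s u : R := prob s (until_event L [set u]).

(** States of [L] are left out of the sum: there [exit_prob] is a hitting probability inside [L],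
    not an exit probability. *)
Definition exit_mean L (h : state M -> R) s : R :=
  \sum_(u | u \notin L) exit_prob L s u * h u.

Lemma exit_mean_out L h s : ~ L s -> exit_mean L h s = h s.
Proof.
move=> Ls; have sL : s \notin L by rewrite notin_setE.
rewrite /exit_mean (bigD1 s)//= big1 ?addr0 => [|u /andP[_ us]].
  by rewrite /exit_prob prob_until_out// mem_set ?mul1r.
rewrite /exit_prob prob_until_out// memNset ?mul0r//= => su.
by rewrite su eqxx in us.
Qed.

Lemma exit_mean_step L h s : L s ->
  exit_mean L h s = \sum_t trans s t * exit_mean L h t.
Proof.
move=> Ls; under [RHS]eq_bigr do rewrite mulr_sumr.
rewrite exchange_big/=; apply: eq_bigr => u uL.
rewrite /exit_prob prob_until_step//.
  by rewrite mulr_suml; apply: eq_bigr => t _; rewrite mulrA.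
by move=> su; move: uL; rewrite -su notin_setE.
Qed.

(* Uniqueness for the Dirichlet problem on [L]. *)
Lemma exit_mean_unique L (x h : state M -> R) : leaves L ->
  (forall s, L s -> x s = \sum_t trans s t * x t) ->
  (forall s, ~ L s -> x s = h s) -> forall s, x s = exit_mean L h s.
Proof.
move=> Lv xL xN s; apply/eqP; rewrite -subr_eq0; apply/eqP.
apply: (maximum_principle_eq0 Lv (d := fun s => x s - exit_mean L h s)).
- move=> u Lu; rewrite xL// exit_mean_step// -sumrB.
  by apply: eq_bigr => t _; rewrite mulrBr.
- by move=> u Lu; rewrite exit_mean_out// xN// subrr.
Qed.

(** Both sides are harmonic on [L], since [A] is never met there, and both equal the indicator of
    [A] off [L]. *)
Lemma exit_mean_until L A s : leaves L -> A `&` L = set0 ->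
  prob s (until_event L A) = exit_mean L (fun u => (u \in A)%:R) s.
Proof.
move=> Lv AL.
apply: (exit_mean_unique (x := fun s => prob s (until_event L A))) => // u Lu.
  by apply: prob_until_step => // Au; rewrite -[False]/(set0 u) -AL.
exact: prob_until_out.
Qed.

(** Constants are harmonic; for [c = 1] this says that [L] is left almost surely. *)
Lemma exit_mean_cst L c s : leaves L -> exit_mean L (fun=> c) s = c.
Proof.
move=> Lv; apply/esym/(exit_mean_unique (x := fun=> c)) => // u _.
by rewrite -mulr_suml trans_sum1 mul1r.
Qed.

End Reachability.

(** * Comparing the exit distributions of related states *)

Section ExitMean.
Local Open Scope classical_set_scope.
Context (R : realType) (AP : countType) (M : finite_lmc R AP).
Implicit Types (s t u v : state M) (L A : set (state M)) (h : state M -> R).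

Lemma exit_prob_ge0 L s u : 0 <= exit_prob L s u.
Proof. exact: prob_ge0. Qed.

Lemma exit_mean_ge0 L h s : (forall u, 0 <= h u) -> 0 <= exit_mean L h s.
Proof. by move=> h0; apply: sumr_ge0 => u _; rewrite mulr_ge0// exit_prob_ge0. Qed.

Lemma exit_meanD L h h' s :
  exit_mean L (fun u => h u + h' u) s = exit_mean L h s + exit_mean L h' s.
Proof. by rewrite -big_split; apply: eq_bigr => u _; rewrite mulrDr. Qed.

Lemma exit_meanN L h s : exit_mean L (fun u => - h u) s = - exit_mean L h s.
Proof. by rewrite -sumrN; apply: eq_bigr => u _; rewrite mulrN. Qed.

Lemma same_label_eq s t : label s = label t -> same_label t = same_label s.
Proof. by rewrite /same_label => ->. Qed.

Lemma exit_mean_bisim eps (B : state M -> state M -> Prop) s t h h' :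
  weak_bisimulation eps B -> B s t ->
  leaves (same_label s) ->
  (forall u, 0 <= h u <= 1) -> (forall u, 0 <= h' u) ->
  (forall u v, B u v -> h u <= h' v) ->
  exit_mean (same_label s) h s <= exit_mean (same_label s) h' t + eps.
Proof.
move=> [_ _ bB] Bst; set L := same_label s => Lv h01 h'0 hh'.
have tL : same_label t = L by apply: same_label_eq; have [] := bB _ _ set0 Bst.
(* Extending the exit distribution by zero turns exit means into sums over all states, as
   [weighted_sum_domination] expects. *)
pose k v u := if u \notin L then exit_prob L v u else 0.
have kE v (x : state M -> R) : exit_mean L x v = \sum_u k v u * x u.
  rewrite /exit_mean big_mkcond; apply: eq_bigr => u _.
  by rewrite /k; case: ifP; rewrite ?mul0r.
have k0 v u : 0 <= k v u by rewrite /k; case: ifP => // _; exact: exit_prob_ge0.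
rewrite !kE -[eps]mul1r; apply: (weighted_sum_domination (rel := B)) => //.
(* Since [k] vanishes on [L], only [A'] matters. Related states share labels, so the image of [A']
   also avoids [L], and both until-probabilities are exit means. *)
move=> A; pose A' := A `\` L.
have A'L : A' `&` L = set0 by apply/seteqP; split => // u [[]].
have BA'L : rel_image B A' `&` L = set0.
  apply/seteqP; split => // u [[v [_ vL] Bvu] uL]; apply: vL.
  by have [e _] := bB _ _ set0 Bvu; rewrite /L/= /same_label/= e.
have [_] := bB _ _ A' Bst; rewrite tL !probE; try exact: measurable_until.
rewrite -EFinD lee_fin !exit_mean_until// !kE => le.
apply: le_trans (le_trans le _).
  rewrite big_mkcond ler_sum// => u _; rewrite /k.
  have [uA|_] := boolP (u \in A); last first.
    by case: ifP; rewrite ?mulr_ge0 ?exit_prob_ge0.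
  case: ifPn => uL; last by rewrite mul0r.
  by rewrite mem_set ?mulr1//; split; [exact: set_mem|move: uL; rewrite notin_setE].
rewrite lerD2r [leRHS]big_mkcond ler_sum// => u _.
case: (boolP (u \in _)) => [/set_mem[v [Av _] Bvu]|_]; last first.
  by rewrite mulr0; case: ifP.
by rewrite mem_set ?mulr1//; exists v.
Qed.

End ExitMean.

(** * Bounding an expectation from below by indicators *)

Section Expectation.
Local Open Scope classical_set_scope.

(** [X] is an arbitrary function, so monotonicity is read off the integral as a supremum over simple
    functions below the integrand. *)
Lemma expectation_ge_sum_indic d (T : measurableType d) (R : realType)
    (P : probability T R) (X : T -> R) n (A : nat -> set T) :
  (forall i, measurable (A i)) -> (forall x, \sum_(i < n) \1_(A i) x <= X x) ->
  (\sum_(i < n) P (A i) <= 'E_P[X])%E.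
Proof.
move=> mA AX.
have -> : (\sum_(i < n) P (A i) = \int[P]_x \sum_(i < n) (\1_(A i) x)%:E)%E.
  rewrite ge0_integral_sum//; last first.
    by move=> i; apply/measurable_realfun.measurable_EFinP; exact: measurable_indic.
  by apply: eq_bigr => i _; rewrite integral_indic// setIT.
have S0 x : (0 <= \sum_(i < n) (\1_(A i) x)%:E :> \bar R)%E.
  by apply: sume_ge0 => i _; rewrite lee_fin.
have SX x : (\sum_(i < n) (\1_(A i) x)%:E <= (X x)%:E)%E by rewrite sumEFin lee_fin.
rewrite expectation.unlock ge0_integralTE// ge0_integralTE; last first.
  by move=> x; exact: le_trans (S0 x) (SX x).
apply: le_ereal_sup => _ [h /= hS <-]; exists h => //= x.
exact: le_trans (hS x) (SX x).
Qed.

End Expectation.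

(** * Expected number of label changes *)

Section Survival.
Local Open Scope classical_set_scope.
Context (R : realType) (AP : countType) (M : finite_lmc R AP).
Variable T : set (state M).
Implicit Types (s t u v : state M) (w : ipath M).

Definition stays n : set (ipath M) := [set w | forall i, (i < n)%N -> T (w i)].

(** [T] is required up to time [i] only, so a change on entering the first state outside [T]
    counts. *)
Definition changes_at i : set (ipath M) :=
  stays i.+1 `&` [set w | label (w i) <> label (w i.+1)].

Lemma measurable_stays n : measurable (stays n).
Proof. exact: measurable_prefix. Qed.

Lemma measurable_changes_at i : measurable (changes_at i).
Proof.
apply: measurableI; first exact: measurable_stays.
have -> : [set w : ipath M | label (w i) <> label (w i.+1)] =
    \bigcup_(u : state M) ([set w : ipath M | w i = u] `&`
      [set w | label u <> label (w i.+1)]).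
  by apply/seteqP; split => [w ?|w [u _ [/= <-]]//]; exists (w i).
apply: countable_bigcupT_measurable => [|u]; first exact: countableP.
apply: measurableI; first exact: (measurable_coord (fun v => v = u)).
exact: (measurable_coord (fun v => label u <> label v)).
Qed.

Lemma prob_stays_step s n : T s ->
  prob s (stays n.+1) = \sum_t trans s t * prob t (stays n).
Proof.
move=> Ts; rewrite prob_step; last exact: measurable_stays.
suff -> : cons_path s @^-1` stays n.+1 = stays n by [].
apply/seteqP; split => w wn; first by move=> i ni; exact: (wn i.+1).
by move=> -[|i]//; exact: wn.
Qed.

Definition changed s t : R := `[< label s <> label t >]%:R.

Lemma prob_changes_at0 s : T s ->
  prob s (changes_at 0) = \sum_t trans s t * changed s t.
Proof.
move=> Ts; rewrite prob_step; last exact: measurable_changes_at.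
apply: eq_bigr => t _; congr (_ * _); apply: prob_start.
  by apply: measurable_cons_preimage; exact: measurable_changes_at.
move=> w w0; split; first by case=> _ /=; rewrite w0 => ?; exact/asboolP.
by move=> /asboolP st; split; [case|rewrite /= w0].
Qed.

Lemma prob_changes_atS s i : T s ->
  prob s (changes_at i.+1) = \sum_t trans s t * prob t (changes_at i).
Proof.
move=> Ts; rewrite prob_step; last exact: measurable_changes_at.
suff -> : cons_path s @^-1` changes_at i.+1 = changes_at i by [].
apply/seteqP; split => w [wn wi]; split => //.
  by move=> j ji; exact: (wn j.+1).
by move=> -[|j]//; exact: wn.
Qed.

Definition expected_changes n s : R := \sum_(i < n) prob s (changes_at i).

Lemma expected_changesS n s : T s ->
  expected_changes n.+1 s =
  \sum_t trans s t * (changed s t + expected_changes n t).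
Proof.
move=> Ts; rewrite /expected_changes big_ord_recl prob_changes_at0//.
under [RHS]eq_bigr do rewrite mulrDr mulr_sumr.
rewrite big_split/=; congr (_ + _); rewrite exchange_big/=.
by apply: eq_bigr => i _; exact: prob_changes_atS.
Qed.

Lemma expected_changes_ge0 n s : 0 <= expected_changes n s.
Proof. by apply: sumr_ge0 => i _; exact: prob_ge0. Qed.

Hypothesis leavesT : leaves T.

(** As a function of the start, this probability is harmonic on [T] and zero off [T]. *)
Lemma prob_stays_forever s : path_measure s (\bigcap_n stays n) = 0%E.
Proof.
have mS : measurable (\bigcap_n stays n).
  by apply: bigcap_measurableType => n _; exact: measurable_stays.
rewrite probE//; congr EFin.
apply: (maximum_principle_eq0 leavesT (d := fun s => prob s (\bigcap_n stays n))).
  move=> u Tu; rewrite prob_step//.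
  suff -> : cons_path u @^-1` (\bigcap_n stays n) = \bigcap_n stays n by [].
  apply/seteqP; split => w wn n _ i ni.
    exact: (wn n.+1 I i.+1).
  by case: i ni => [//|i] ni; exact: (wn n I i (ltnW ni)).
move=> u Tu; apply: (prob_start (b := false)) => // w w0; split => // wn.
by exfalso; apply: Tu; rewrite -w0; exact: (wn 1%N I 0%N).
Qed.

Lemma prob_stays_small s (d : R) : 0 < d -> exists n, prob s (stays n) < d.
Proof.
move=> d0; have mS n := measurable_stays n.
have : (path_measure s \o stays) @ \oo --> path_measure s (\bigcap_n stays n).
  apply: nonincreasing_cvg_mu => //.
  - by rewrite [ltLHS]probE ?ltry.
  - exact: bigcap_measurableType.
  - move=> m n mn; apply/subsetPset => w wn i im; apply: wn.
    exact: leq_trans mn.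
rewrite prob_stays_forever => /fine_cvgP[_].
move=> /cvgr_lt - /(_ _ d0)[n _ /(_ n (leqnn n))] /= h.
by exists n.
Qed.

(** The one-step inequality is unfolded [n] times; paths still in [T] contribute at most the uniform
    bound [C]. *)
Lemma changes_bound (eps C : R) (x : state M -> R) n s :
  0 <= eps -> 0 <= C -> (forall s, x s <= C) ->
  (forall s, T s -> x s <= \sum_t trans s t * (x t + eps * changed s t)) ->
  (forall s, ~ T s -> x s <= 0) ->
  x s <= eps * expected_changes n s + C * prob s (stays n).
Proof.
move=> eps0 C0 xC xT xN; elim: n s => [|n ih] s.
  rewrite /expected_changes big_ord0 mulr0 add0r.
  rewrite (_ : prob s _ = 1) ?mulr1//.
  by apply: (prob_start (b := true)); first exact: measurable_stays.
have [Ts|Ts] := pselect (T s); last first.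
  apply: le_trans (xN _ Ts) _.
  by rewrite addr_ge0// mulr_ge0 ?expected_changes_ge0 ?prob_ge0.
rewrite expected_changesS// prob_stays_step// !mulr_sumr -big_split/=.
apply: le_trans (xT _ Ts) _; apply: ler_sum => t _.
rewrite mulrCA [C * _]mulrCA -mulrDr ler_wpM2l ?trans_ge0//.
by have := ih t; lra.
Qed.

End Survival.

(** * Gap between related states *)

Section Main.
Local Open Scope classical_set_scope.
Context (R : realType) (AP : countType) (M : finite_lmc R AP) (g f : AP).
Hypothesis hf : forall u : state M, label u f <-> ~ can_reach_label u g.
Implicit Types (s t u v : state M) (w : ipath M).

Definition undecided : set (state M) := [set s | ~ (label s g \/ label s f)].

Lemma undecided_reach s : undecided s -> can_reach_label s g.
Proof. by move=> us; apply: contrapT => /hf sf; apply: us; right. Qed.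

Lemma leaves_undecided : leaves undecided.
Proof.
by move=> s /undecided_reach[v sv vg]; exists v => //; apply; left.
Qed.

Lemma undecided_label s t : label s = label t -> undecided s -> undecided t.
Proof. by rewrite /undecided/= => ->. Qed.

(** A [g]-labeled state is reachable from the whole class of [s] and cannot belong to it. *)
Lemma leaves_same_label s : undecided s -> leaves (same_label s).
Proof.
move=> us t ts; have [] := @undecided_reach t; first exact: undecided_label us.
by move=> v tv vg; exists v => // vs; apply: us; left; rewrite -vs.
Qed.

(** Every change counted on the left precedes the hitting time [k]. Without a hit, [xget] would
    return [0] and no change would be counted on the right. *)
Lemma label_changes_until_ge n w :
  (exists k, ~ undecided (w k)) ->
  (\sum_(i < n) `[< changes_at undecided i w >] <= label_changes_until g f w)%N.
Proof.
move=> wk; rewrite /label_changes_until; set k := xget _ _.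
have [kT _] : first_hit g f w k.
  rewrite /k; case: xgetP => [//|nk]; exfalso.
  have [k0 k0P] := wk.
  have ex : exists k, `[< ~ undecided (w k) >] by exists k0; exact/asboolP.
  apply: (nk (ex_minn ex)); case: ex_minnP => m /asboolP/contrapT mT mmin.
  split => // i im iT; have := mmin i; rewrite leqNgt im => h.
  by have : false by apply: h; apply/asboolP.
have before i : changes_at undecided i w -> (i < k)%N.
  by move=> [wi _]; rewrite ltnNge; apply/negP => ki; exact: (wi k).
pose F i : nat := `[< changes_at undecided i w >].
rewrite -[X in (X <= _)%N]/(\sum_(i < n) F i)%N.
(* Lengthening the sum to [n + k] lets it be cut at [k], beyond which all terms vanish. *)
apply: (@leq_trans (\sum_(i < n + k) F i)%N).
  by rewrite big_split_ord/= leq_addr.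
rewrite addnC big_split_ord/= [X in (_ + X)%N]big1 ?addn0; last first.
  move=> i _; rewrite /F; case: asboolP => // /before.
  by rewrite ltnNge leq_addr.
rewrite /label_changes -sum1_card [leqRHS]big_mkcond/= leq_sum// => i _.
rewrite /F; case: asboolP => // -[_ ch].
by rewrite inE; case: asboolP.
Qed.

Lemma expected_changes_le n s :
  ((expected_changes undecided n s)%:E <=
   'E_(path_measure s)[fun w => (label_changes_until g f w)%:R])%E.
Proof.
pose forever : set (ipath M) := \bigcap_n stays undecided n.
have mforever : measurable forever.
  by apply: bigcap_measurableType => k _; exact: measurable_stays.
have mch i : measurable (changes_at undecided i : set (ipath M)).
  exact: measurable_changes_at.
(* The paths that stay undecided forever are removed: they form a null set, and the pathwise bound
   may fail on them. *)
have -> : (expected_changes undecided n s)%:E =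
    (\sum_(i < n) path_measure s (changes_at undecided i `\` forever))%E.
  rewrite /expected_changes -sumEFin; apply: eq_bigr => i _.
  rewrite -probE// (measureDI (path_measure s) (mch i) mforever).
  rewrite [X in (_ + X)%E](_ : _ = 0%E) ?adde0//; apply/eqP.
  rewrite eq_le measure_ge0 andbT -(prob_stays_forever leaves_undecided s).
  exact: measureIr.
apply: (@expectation_ge_sum_indic _ _ _ (path_measure s) _ n
  (fun i => changes_at undecided i `\` forever)) => [i|w].
  exact: measurableD.
have [wk|nk] := pselect (exists k, ~ undecided (w k)); last first.
  rewrite big1// => i _; rewrite indicE memNset// => -[_]; apply => m _ j _.
  by apply: contrapT => uj; apply: nk; exists j.
apply: (@le_trans _ R (\sum_(i < n) `[< changes_at undecided i w >])%N%:R).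
  rewrite natr_sum ler_sum// => i _; rewrite indicE.
  by case: (boolP (w \in _)) => // /set_mem[ci _]; case: asboolP.
by rewrite ler_nat label_changes_until_ge.
Qed.

Variables (eps : R) (B : state M -> state M -> Prop).
Hypotheses (eps0 : 0 <= eps) (bisB : weak_bisimulation eps B).

Let p s : R := prob s (eventually_event g).

Let p_ge0 s : 0 <= p s. Proof. exact: prob_ge0. Qed.

Let p_le1 s : p s <= 1.
Proof. by apply: prob_le1; exact: measurable_eventually. Qed.

Let bisC s t : B s t -> B t s. Proof. by case: bisB => _ + _; exact. Qed.

Let bis_label s t : B s t -> label s = label t.
Proof. by case: bisB => _ _ /(_ s t set0) + st => /(_ st)[]. Qed.

Definition max_gap s : R := \big[Num.max/0]_(t | `[< B s t >]) `|p s - p t|.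

Lemma max_gap_ge0 s : 0 <= max_gap s.
Proof. exact: bigmax_ge_id. Qed.

Lemma max_gap_ge s t : B s t -> `|p s - p t| <= max_gap s.
Proof.
by move=> st; rewrite /max_gap; apply: le_bigmax_cond; exact/asboolP.
Qed.

Lemma max_gap_le s c : 0 <= c -> (forall t, B s t -> `|p s - p t| <= c) ->
  max_gap s <= c.
Proof. by move=> c0 h; apply: bigmax_le => // t /asboolP/h. Qed.

(** Related states share labels: under [g] both probabilities are one, under [f] both are zero. *)
Lemma max_gap_decided s : ~ undecided s -> max_gap s = 0.
Proof.
move=> us; apply/eqP; rewrite eq_le max_gap_ge0 andbT.
apply: max_gap_le => // t st.
suff -> : p s = p t by rewrite subrr normr0.
have e := bis_label st; move: us => /contrapT[sg|sf].
  by rewrite /p !prob_eventually1// -e.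
by rewrite /p !prob_eventually0//; apply/hf => //; rewrite -e.
Qed.

(** The class contains no [g]-labeled state, so [p] is harmonic on it. *)
Lemma exit_mean_eventually s v : undecided s ->
  exit_mean (same_label s) p v = p v.
Proof.
move=> us; apply/esym/exit_mean_unique => //; first exact: leaves_same_label.
move=> u us'; apply: prob_eventually_step => ug.
by apply: us; left; rewrite -us'.
Qed.

(** The right-hand side of the inequality for [D] in the overview. Unlike [max_gap], it comes with a
    recursion over single transitions. *)
Definition gap_bound s : R :=
  if `[< undecided s >]
  then exit_mean (same_label s) (fun u => eps + max_gap u) s else 0.

Lemma gap_bound_ge0 s : 0 <= gap_bound s.
Proof.
rewrite /gap_bound; case: ifP => // _; apply: exit_mean_ge0 => u.
by rewrite addr_ge0// max_gap_ge0.
Qed.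

Lemma max_gap_le_bound s : max_gap s <= gap_bound s.
Proof.
have [us|us] := pselect (undecided s); last first.
  by rewrite max_gap_decided// gap_bound_ge0.
apply: max_gap_le => [|t st]; first exact: gap_bound_ge0.
have Ls := leaves_same_label us.
rewrite /gap_bound asboolT// exit_meanD exit_mean_cst//.
have e := bis_label st.
have tL : same_label t = same_label s by exact: same_label_eq.
have ut : undecided t := undecided_label e us.
have gap u v : B u v -> `|p u - p v| <= max_gap v.
  by move=> uv; rewrite distrC max_gap_ge//; exact: bisC.
have h01 u : 0 <= p u <= 1 by rewrite p_ge0 p_le1.
(* Both comparisons run from [t] to [s], so the mean of [max_gap] is taken at [s], whatever [t] is.
   The choice [p] bounds [p t] from above, [1 - p] from below. *)
have := @exit_mean_bisim _ _ _ _ _ t s p (fun v => p v + max_gap v) bisB (bisC st).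
have := @exit_mean_bisim _ _ _ _ _ t s (fun v => 1 - p v)
  (fun v => (1 - p v) + max_gap v) bisB (bisC st).
rewrite tL !exit_meanD !exit_meanN !exit_mean_cst// !exit_mean_eventually//.
move=> h1 h2.
have {}h1 : 1 - p t <= 1 - p s + exit_mean (same_label s) max_gap s + eps.
  apply: h1 => // [u|u|u v /gap].
  - by have := h01 u; lra.
  - by have := h01 u; have := max_gap_ge0 u; lra.
  - by rewrite ler_norml => /andP[]; lra.
have {}h2 : p t <= p s + exit_mean (same_label s) max_gap s + eps.
  apply: h2 => // [u|u v /gap].
  - by have := h01 u; have := max_gap_ge0 u; lra.
  - by rewrite ler_norml => /andP[]; lra.
by rewrite ler_norml; apply/andP; split; lra.
Qed.

(** A step inside the class keeps the exit mean; a step out of it is a label change, which pays one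
    [eps] and leaves [max_gap t], at most [gap_bound t]. *)
Lemma gap_bound_step s : undecided s ->
  gap_bound s <= \sum_t trans s t * (gap_bound t + eps * changed s t).
Proof.
move=> us; rewrite {1}/gap_bound asboolT// exit_mean_step//.
apply: ler_sum => t _; rewrite ler_wpM2l ?trans_ge0//.
rewrite /changed; case: asboolP => [st|/contrapT st].
  rewrite exit_mean_out; last by move=> ts; apply: st.
  by rewrite mulr1 addrC lerD2r max_gap_le_bound.
rewrite mulr0 addr0 /gap_bound asboolT; last exact: undecided_label us.
by rewrite (same_label_eq st).
Qed.

Lemma gap_bound_limit s y :
  (forall n, eps * expected_changes undecided n s <= y) -> gap_bound s <= y.
Proof.
move=> ey; pose C := \sum_u gap_bound u.
have C0 : 0 <= C by apply: sumr_ge0 => u _; exact: gap_bound_ge0.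
apply/ler_addgt0Pr => d d0.
(* The error [C * prob s (stays n)] is to fall below [d]; dividing by [C + 1] covers [C = 0]. *)
have C1 : 0 < C + 1 by rewrite ltr_wpDl.
have [n nd] := prob_stays_small leaves_undecided s (divr_gt0 d0 C1).
have := @changes_bound _ _ _ undecided eps C gap_bound n s eps0 C0 _ gap_bound_step.
move=> h; apply: le_trans (h _ _) _.
- move=> u; rewrite /C (bigD1 u)//= lerDl sumr_ge0// => v _.
  exact: gap_bound_ge0.
- by move=> u uu; rewrite /gap_bound asboolF.
apply: lerD (ey n) _; apply: le_trans (ler_wpM2l C0 (ltW nd)) _.
by rewrite mulrA ler_pdivrMr// mulrC ler_wpM2l ?ltW// ltrDl.
Qed.

End Main.

Unset Implicit Arguments.

Theorem proposition5p10 (R : realType) (AP : countType) (g f : AP)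
  (hgf : g <> f) (eps : R) (heps : 0 <= eps <= 1) (M : finite_lmc R AP)
  (hg : exists u : state M, label u g)
  (hf : forall u : state M, label u f <-> ~ can_reach_label u g)
  (s t : state M) (hst : weakly_bisimilar eps s t) :
  (`| path_measure s (@eventually_event R AP M g)
      - path_measure t (@eventually_event R AP M g) |
   <= eps%:E * 'E_(path_measure s)[fun w => (label_changes_until g f w)%:R])%E.
Proof.
have [B bisB st] := hst; have /andP[eps0 _] := heps.
have mg : measurable (eventually_event g : set (ipath M)).
  exact: measurable_eventually.
rewrite !probE// -EFinB abse_EFin.
have : `|prob s (eventually_event g) - prob t (eventually_event g)| <=
    gap_bound g f eps B s.
  apply: le_trans (max_gap_le_bound hf eps0 bisB s); exact: max_gap_ge.
have lim := gap_bound_limit hf eps0 bisB (s := s).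
have := expected_changes_le hf ^~ s.
(* The expectation is finite or [+oo]; [-oo] is excluded by the lower bound at [n = 0]. *)
case: expectation => [x|_|/(_ 0%N)//] => [ex|] gap.
  rewrite -EFinM lee_fin; apply: le_trans gap _; apply: lim => n.
  by rewrite ler_wpM2l// -lee_fin.
(* For an infinite expectation and [eps = 0] the product is [0], so the gap itself must vanish; for
   [eps > 0] the bound is infinite. *)
have [eps_eq0|epsN0] := eqVneq eps 0; last first.
  by rewrite gt0_muley ?leey// lte_fin lt_neqAle eq_sym epsN0.
rewrite eps_eq0 mul0e lee_fin; apply: le_trans gap _; apply: lim => n.
by rewrite eps_eq0 mul0r.
Qed.
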